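(* Let $G$ be a finite triangle-free graph which is not of the form $K_{1,t}$ with $t\ge1$, and not of the form $K_{1,t}\cup sK_1$ (a star $K_{1,t}$ together with $s$ isolated vertices) with $s,t\ge 1$. Then $\chi_f(G)=Z_f(G)$.
   Context: A fractional coloring of $G$ is an assignment of nonnegative real weights to the independent sets of $G$ such that for every vertex $v$ the total weight of the independent sets containing $v$ is at least $1$; $\chi_f(G)$ is the minimum total weight of a fractional coloring. A fractional cocoloring is defined the same way but weights are assigned to cliques and independent sets, each vertex being covered by total weight at least $1$; $Z_f(G)$ is the minimum total weight of a fractional cocoloring. *)

(* Defs.v *)
From mathcomp Require Import all_boot all_order all_algebra.
From mathcomp Require Import all_classical all_reals all_analysis.

Set Implicit Arguments.
Unset Strict Implicit.
Unset Printing Implicit Defensive.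

Import Order.TTheory GRing.Theory Num.Theory.
Import numFieldNormedType.Exports.

Local Open Scope ring_scope.

(* A finite simple graph is a finite vertex type with an
   irreflexive symmetric adjacency relation. *)

Section Graphs.
Variables (T : finType) (e : rel T).

Definition simple_graph : Prop := symmetric e /\ irreflexive e.

Definition independent (A : {set T}) : bool :=
  [forall x in A, forall y in A, ~~ e x y].

Definition clique (A : {set T}) : bool :=
  [forall x in A, forall y in A, (x != y) ==> e x y].

Definition triangle_free : Prop :=
  forall A : {set T}, clique A -> #|A| <> 3%N.

End Graphs.

Definition graph_iso (T U : finType) (e : rel T) (f : rel U) : Prop :=
  exists2 h : T -> U, bijective h & forall x y, f (h x) (h y) = e x y.

Definition complete_bipartite (m n : nat) : rel ('I_m + 'I_n)%type :=
  fun x y => match x, y with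
             | inl _, inr _ | inr _, inl _ => true
             | _, _ => false
             end.

Definition edgeless (n : nat) : rel 'I_n := fun _ _ => false.

Arguments complete_bipartite : clear implicits.
Arguments edgeless : clear implicits.

Definition graph_union (T U : finType) (e : rel T) (f : rel U) :
    rel (T + U)%type :=
  fun x y => match x, y with
             | inl a, inl b => e a b
             | inr a, inr b => f a b
             | _, _ => false
             end.

Section FractionalCovers.
Variables (R : realType) (T : finType).

(* [P] selects the admissible sets; the values of [w] elsewhere are ignored. *)
Definition fractional_cover (P : pred {set T}) (w : {set T} -> R) : Prop :=
  (forall A, P A -> 0 <= w A) /\
  (forall v, 1 <= \sum_(A : {set T} | P A && (v \in A)) w A).

Definition total_weight (P : pred {set T}) (w : {set T} -> R) : R :=
  \sum_(A : {set T} | P A) w A.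

(* The infimum is a minimum: see [chi_f_min] and [Z_f_min] below. *)
Definition fractional_cover_number (P : pred {set T}) : R :=
  inf [set total_weight P w | w in [set w | fractional_cover P w]]%classic.

End FractionalCovers.

Definition fractional_coloring (R : realType) (T : finType) (e : rel T)
    (w : {set T} -> R) : Prop :=
  fractional_cover (independent e) w.

Definition chi_f (R : realType) (T : finType) (e : rel T) : R :=
  fractional_cover_number R (independent e).

(* Sets that are both cliques and independent (at most one vertex, when [e] is
   irreflexive) carry a single weight. *)
Definition fractional_cocoloring (R : realType) (T : finType) (e : rel T)
    (w : {set T} -> R) : Prop :=
  fractional_cover [predU clique e & independent e] w.

Definition Z_f (R : realType) (T : finType) (e : rel T) : R :=
  fractional_cover_number R [predU clique e & independent e].

Section Attained.
Variables (R : realType) (T : finType).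
Local Open Scope classical_set_scope.

Lemma fractional_cover_argmin (P : pred {set T}) :
  (forall v, P [set v]%SET) ->
  exists2 w : {set T} -> R, fractional_cover P w &
    forall w', fractional_cover P w' -> total_weight P w <= total_weight P w'.
Proof.
move=> P1; pose N : R := #|{set T}|%:R.
pose X : topologicalType := {ptws {set T} -> R}.
pose K : set X := [set w : {set T} -> R | forall A, `[0, N]%classic (w A)].
pose C : set X := K `&` [set w | fractional_cover P w].
have csum (Q : pred {set T}) : continuous (fun w : X => \sum_(A | Q A) w A).
  apply: continuous_big; first exact: add_continuous.
  by move=> A _; exact: (@proj_continuous _ (fun=> R) A).
have Kc : compact K.
  exact: (@tychonoff _ (fun=> R) (fun=> `[0, N]%classic)
            (fun=> @segment_compact _ _ _)).
have Cc : compact C.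
  have -> : C = K `&`
      \bigcap_(v in [set: T])
        [set w | 1 <= \sum_(A : {set T} | P A && (v \in A)) w A].
    apply/seteqP; split=> w [Kw].
      by case=> _ Hw; split=> // v _; exact: Hw.
    move=> Hw; split=> //; split=> [A _|v]; last exact: (Hw v).
    by have := Kw A; rewrite /= in_itv /= => /andP[].
  apply: compact_closedI => //; apply: closed_bigI => v _.
  have /continuous_closedP := csum (fun A => P A && (v \in A)).
  by move=> /(_ _ (@closed_ge R 1)).
have one_cover : fractional_cover P (fun=> 1 : R).
  split=> // v; rewrite (bigD1 [set v]%SET) /=; last by rewrite P1 set11.
  by rewrite lerDl sumr_ge0.
have N1 : (1 : R) <= N.
  by rewrite ler1n; apply/card_gt0P; exists finset.set0.
have C1 : C (fun=> 1 : R).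
  by split=> // A; rewrite /= in_itv /= ler01.
have [w /set_mem[Kw cw] wmin] :=
  @compact_EVT_min X R (total_weight P) C (ex_intro _ _ C1) Cc
    (continuous_subspaceT (csum P)).
exists w => // w' [w'0 w'1].
have [leN|ltN] := leP (total_weight P w') N; last first.
  apply: le_trans (ltW ltN); apply: le_trans (wmin _ (mem_set C1)) _.
  by rewrite /total_weight sumr_const ler_nat max_card.
pose w'' A := if P A then w' A else 0.
have w''E (Q : pred {set T}) : (forall A, Q A -> P A) ->
    \sum_(A | Q A) w'' A = \sum_(A | Q A) w' A.
  by move=> QP; apply: eq_bigr => A /QP PA; rewrite /w'' PA.
rewrite -[leRHS](w''E P) //; apply: wmin; apply/mem_set; split.
  move=> A; rewrite /= in_itv /= /w''; case: ifP => PA; last by rewrite lexx ler0n.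
  rewrite w'0 //=; apply: le_trans leN; rewrite /total_weight (bigD1 A) //= lerDl.
  by apply: sumr_ge0 => B /andP[/w'0].
split=> [A PA|v]; first by rewrite /w'' PA w'0.
by rewrite w''E // => A /andP[].
Qed.

Lemma fractional_cover_number_min (P : pred {set T}) :
  (forall v, P [set v]%SET) ->
  (exists2 w : {set T} -> R, fractional_cover P w &
     total_weight P w = fractional_cover_number R P) /\
  (forall w : {set T} -> R, fractional_cover P w ->
     fractional_cover_number R P <= total_weight P w).
Proof.
move=> /fractional_cover_argmin[w cw wmin].
have lbw : lbound [set total_weight P w | w in [set w | fractional_cover P w]]
             (total_weight P w) by move=> _ [w' /wmin ? <-].
have E : total_weight P w = fractional_cover_number R P.
  apply/eqP; rewrite eq_le; apply/andP; split.
    by apply: lb_le_inf => //; exists (total_weight P w), w.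
  by apply: ge_inf; [exists (total_weight P w) | exists w].
by split; [exists w | move=> w' /wmin; rewrite E].
Qed.

Lemma chi_f_min (e : rel T) : irreflexive e ->
  (exists2 w : {set T} -> R, fractional_coloring e w &
     total_weight (independent e) w = chi_f R e) /\
  (forall w : {set T} -> R, fractional_coloring e w ->
     chi_f R e <= total_weight (independent e) w).
Proof.
move=> eI; apply: fractional_cover_number_min => v.
apply/forall_inP => x /set1P->; apply/forall_inP => y /set1P->.
by rewrite eI.
Qed.

Lemma Z_f_min (e : rel T) :
  (exists2 w : {set T} -> R, fractional_cocoloring e w &
     total_weight [predU clique e & independent e] w = Z_f R e) /\
  (forall w : {set T} -> R, fractional_cocoloring e w ->
     Z_f R e <= total_weight [predU clique e & independent e] w).
Proof.
apply: fractional_cover_number_min => v; apply/orP; left.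
apply/forall_inP => x /set1P->; apply/forall_inP => y /set1P->.
by rewrite eqxx.
Qed.

End Attained.

(* Main.v *)
(** Among the fractional cocolorings of minimum total weight, take one, [w],
    minimizing the sum of [w A] times ([#|A|], plus one if [A] is not
    independent).  Then every vertex is covered by exactly 1, since otherwise it
    could be removed from a set of positive weight.  In a triangle-free graph an
    edge [{a, b}] and a disjoint clique or independent set together span a
    bipartite graph, so if both had positive weight, moving weight to the two
    colour classes would decrease the secondary cost; hence every set of positive
    weight meets each edge of positive weight.  If no edge has positive weight,
    then [w] is a fractional coloring.  If some edge [{a, b}] does, adding the
    coverages of [a] and [b] counts every set of the support, and [{a, b}] twice,
    so the total weight is less than 2.  But two disjoint edges force total weight
    at least 2, because no clique or independent set contains more than two of
    their four ends; so all edges pairwise meet, and the graph is a star, possibly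
    with isolated vertices. *)
Require Import Defs.
From mathcomp Require Import all_boot all_order all_algebra.
From mathcomp Require Import all_classical all_reals all_analysis.
From mathcomp Require Import lra.

Set Implicit Arguments.
Unset Strict Implicit.
Unset Printing Implicit Defensive.

Import Order.TTheory GRing.Theory Num.Theory.
Import numFieldNormedType.Exports.

Local Open Scope ring_scope.

(** * Covers that are optimal for a secondary linear cost *)

Section OptimalCovers.
Variables (R : realType) (T : finType).
Implicit Types (P : pred {set T}) (w c d : {set T} -> R).

(** For a [w] of minimum total weight this is the second stage of lexicographic minimality. *)
Definition cost_minimal P c w : Prop :=
  forall w', fractional_cover P w' ->
    total_weight P w' <= total_weight P w ->
    \sum_(A | P A) c A * w A <= \sum_(A | P A) c A * w' A.

(** Compactness: the covers of total weight at most [Z] with values in [[0, Z]] form a compact set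
    in the product topology, and the cost is continuous. *)
Lemma exists_cost_minimal P c : (forall v, P [set v]%SET) ->
  exists w, [/\ fractional_cover P w,
    total_weight P w = fractional_cover_number R P & cost_minimal P c w].
Proof.
move=> P1; have [[w0 cw0 tw0] Zmin] := fractional_cover_number_min R P1.
set Z := fractional_cover_number R P in tw0 Zmin *.
have Z0 : 0 <= Z by rewrite -tw0; apply: sumr_ge0 => A; apply: cw0.1.
pose X : topologicalType := {ptws {set T} -> R}.
pose C : set X := ([set w : X | forall A, `[0%R, Z]%classic (w A)] `&`
  ((\bigcap_(v in [set: T])
      [set w : X | 1 <= \sum_(A : {set T} | P A && (v \in A)) w A]) `&`
   [set w : X | total_weight P w <= Z]))%classic.
have csum (Q : pred {set T}) (b : {set T} -> R) :
    continuous (fun w : X => \sum_(A | Q A) b A * w A).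
  apply: continuous_big; first exact: add_continuous.
  move=> A _ w; apply: continuousM; first exact: cst_continuous.
  exact: (@proj_continuous _ (fun=> R) A).
have csum1 (Q : pred {set T}) : continuous (fun w : X => \sum_(A | Q A) w A).
  have -> : (fun w : X => \sum_(A | Q A) w A)
      = (fun w : X => \sum_(A | Q A) 1 * w A).
    by apply/funext => w; apply: eq_bigr => A _; rewrite mul1r.
  exact: csum.
have Cc : compact C.
  apply: compact_closedI.
    exact: (@tychonoff _ (fun=> R) (fun=> `[0%R, Z]%classic)
              (fun=> @segment_compact _ _ _)).
  apply: closedI.
    apply: closed_bigI => v _.
    have /continuous_closedP := csum1 (fun A => P A && (v \in A)).
    by move=> /(_ _ (@closed_ge R 1)).
  have /continuous_closedP := csum1 P.
  by move=> /(_ _ (@closed_le R Z)).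
(* A cover is unconstrained outside [P]; setting it to 0 there puts it into the compact box and
   changes no relevant sum. *)
pose trunc w A := if P A then w A else 0.
have truncE w (Q : pred {set T}) b : (forall A, Q A -> P A) ->
    \sum_(A | Q A) b A * trunc w A = \sum_(A | Q A) b A * w A.
  by move=> QP; apply: eq_bigr => A /QP PA; rewrite /trunc PA.
have truncE1 w (Q : pred {set T}) : (forall A, Q A -> P A) ->
    \sum_(A | Q A) trunc w A = \sum_(A | Q A) w A.
  by move=> QP; apply: eq_bigr => A /QP PA; rewrite /trunc PA.
have truncC w : fractional_cover P w -> total_weight P w <= Z -> C (trunc w).
  move=> [w1 w2] tw; split; last split.
  - move=> A; rewrite /= in_itv /= /trunc; case: ifP => PA; last by rewrite lexx.
    rewrite w1 //=; apply: le_trans tw; rewrite /total_weight (bigD1 A) //= lerDl.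
    by apply: sumr_ge0 => B /andP[/w1].
  - by move=> v _ /=; rewrite truncE1 // => A /andP[].
  - by rewrite /= /total_weight truncE1.
have Cw0 : C (trunc w0) by apply: truncC => //; rewrite tw0.
have [w /set_mem [Kw [Vw tw]] wmin] :=
  @compact_EVT_min X R (fun w => \sum_(A | P A) c A * w A) C
    (ex_intro _ _ Cw0) Cc (continuous_subspaceT (csum P c)).
have cw : fractional_cover P w.
  split=> [A _|v]; last exact: (Vw v).
  by have := Kw A; rewrite /= in_itv /= => /andP[].
have twE : total_weight P w = Z by apply/le_anti; rewrite tw Zmin.
exists w; split=> // w' cw'; rewrite twE => tw'.
by rewrite -(truncE w') //; apply: wmin; apply/mem_set; apply: truncC.
Qed.

Lemma small_step (I : finType) (a b : I -> R) :
  (forall i, 0 <= a i) -> (forall i, b i < 0 -> 0 < a i) ->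
  exists2 t : R, 0 < t & forall i, 0 <= a i + t * b i.
Proof.
(* The least ratio at which a decreasing coordinate reaches 0; the default 1 keeps the minimum
   positive when nothing decreases. *)
move=> a0 ab; exists (\big[Num.min/1]_(i | b i < 0) (a i / - b i)).
  by apply: lt_bigmin => // i bi; rewrite divr_gt0 ?oppr_gt0 ?ab.
move=> i; have [bi|bi] := ltP (b i) 0; last first.
  rewrite addr_ge0 // mulr_ge0 // le_bigmin // => j bj.
  by rewrite divr_ge0 ?oppr_ge0 ?ltW ?ab.
have : \big[Num.min/1]_(i | b i < 0) (a i / - b i) <= a i / - b i.
  exact: bigmin_le_cond.
by rewrite ler_pdivlMr ?oppr_gt0 // mulrN lerNl -subr_ge0 opprK addrC.
Qed.

(** First-order optimality: [d] lowers only positive weights and only slack coverages, so a small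
    step along it stays feasible with the same total weight. *)
Lemma cost_minimal_direction P c w d :
  fractional_cover P w -> cost_minimal P c w ->
  \sum_(A | P A) d A = 0 ->
  (forall A, P A -> d A < 0 -> 0 < w A) ->
  (forall v, \sum_(A | P A && (v \in A)) d A < 0 ->
             1 < \sum_(A | P A && (v \in A)) w A) ->
  0 <= \sum_(A | P A) c A * d A.
Proof.
move=> [w0 w1] wmin d0 dA dv.
(* Nonnegativity and coverage constraints share one index type, so that a single step length serves
   both. *)
pose a (i : {set T} + T) : R := match i with
  | inl A => if P A then w A else 0
  | inr v => \sum_(A | P A && (v \in A)) w A - 1 end.
pose b (i : {set T} + T) : R := match i with
  | inl A => if P A then d A else 0
  | inr v => \sum_(A | P A && (v \in A)) d A end.
have [||t t0 tP] := @small_step _ a b.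
- by case=> [A|v] /=; [case: ifP => // /w0 | rewrite subr_ge0].
- case=> [A|v] /=; first by case: ifP => [/dA|]; rewrite ?ltxx.
  by rewrite subr_gt0; apply: dv.
have sumE (Q : pred {set T}) : \sum_(A | Q A) (w A + t * d A) =
    \sum_(A | Q A) w A + t * \sum_(A | Q A) d A.
  by rewrite big_split /= mulr_sumr.
have /wmin : fractional_cover P (fun A => w A + t * d A).
  split=> [A PA|v]; first by have := tP (inl A); rewrite /= PA.
  by have := tP (inr v); rewrite sumE /= addrAC subr_ge0.
rewrite /total_weight sumE d0 mulr0 addr0 => /(_ (lexx _)).
under [leRHS]eq_bigr => A _ do rewrite mulrDr (mulrCA _ t).
by rewrite big_split /= -mulr_sumr lerDl pmulr_rge0.
Qed.

Lemma sum_indicator (Q : pred {set T}) (b : {set T} -> R) X :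
  \sum_(A | Q A) b A * (A == X)%:R = if Q X then b X else 0.
Proof.
case: ifP => QX.
  rewrite (bigD1 X) //= eqxx mulr1 big1 ?addr0 // => A /andP[_ /negPf->].
  by rewrite mulr0.
by rewrite big1 // => A; case: (A =P X) => [->|_ _]; rewrite ?QX ?mulr0.
Qed.

(** If [v] were covered by more than 1, shifting a little weight from a set [A] containing [v] to
    [A :\ v] would lower the cost and change no other coverage. *)
Lemma cost_minimal_exact P c w :
  (forall A v, P A -> v \in A -> P (A :\ v)) ->
  (forall A v, P A -> v \in A -> c (A :\ v) < c A) ->
  fractional_cover P w -> cost_minimal P c w ->
  forall v, \sum_(A | P A && (v \in A)) w A = 1.
Proof.
move=> PD cD cw wmin v; apply/le_anti; rewrite cw.2 andbT leNgt.
apply/negP => lt1.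
have [A /andP[/andP[PA vA] wA]] :
    exists A, (P A && (v \in A)) && (0 < w A).
  apply/existsP; apply: contraLR lt1 => /existsPn H; rewrite -leNgt.
  rewrite big1 ?ler01 // => A PA; apply/le_anti.
  rewrite cw.1 ?andbT; last by case/andP: PA.
  by have := H A; rewrite PA /= -leNgt.
pose d B : R := (B == A :\ v)%:R - (B == A)%:R.
have sumE (Q : pred {set T}) (b : {set T} -> R) : \sum_(B | Q B) b B * d B =
    (if Q (A :\ v) then b (A :\ v) else 0) - (if Q A then b A else 0).
  rewrite /d; under eq_bigr => B _ do rewrite mulrBr.
  by rewrite sumrB !sum_indicator.
have sumE1 (Q : pred {set T}) :
    \sum_(B | Q B) d B = (Q (A :\ v))%:R - (Q A)%:R.
  under eq_bigr => B _ do rewrite -(mul1r (d B)).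
  by rewrite sumE; do 2!case: ifP.
have := @cost_minimal_direction P c w d cw wmin.
rewrite sumE sumE1 PD // PA subrr => /(_ erefl) H.
suff : 0 <= c (A :\ v) - c A by rewrite subr_ge0 leNgt cD.
apply: H => [B PB|u].
  by rewrite /d; case: (B =P A) => [-> //|_]; rewrite subr0 ltNge ler0n.
rewrite sumE1 PD // PA /= !inE; have [->//|_] := eqVneq u v.
by rewrite subrr ltxx.
Qed.

(** Shift the same small weight from [X] and [Y] to [X'] and [Y']. Adding indicators in [d] accounts
    for coincidences among the four sets. *)
Lemma cost_minimal_exchange P c w (X Y X' Y' : {set T}) :
  fractional_cover P w -> cost_minimal P c w ->
  P X -> P Y -> P X' -> P Y' -> 0 < w X -> 0 < w Y ->
  (forall v, (v \in X) + (v \in Y) <= (v \in X') + (v \in Y'))%N ->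
  c X + c Y <= c X' + c Y'.
Proof.
move=> cw wmin PX PY PX' PY' wX wY cov.
pose d B : R := (B == X')%:R + (B == Y')%:R - ((B == X)%:R + (B == Y)%:R).
have sumE (Q : pred {set T}) (b : {set T} -> R) : \sum_(B | Q B) b B * d B =
    (if Q X' then b X' else 0) + (if Q Y' then b Y' else 0)
    - ((if Q X then b X else 0) + (if Q Y then b Y else 0)).
  rewrite /d; under eq_bigr => B _ do rewrite mulrBr !mulrDr.
  by rewrite sumrB !big_split /= !sum_indicator.
have sumE1 (Q : pred {set T}) : \sum_(B | Q B) d B =
    ((Q X') + (Q Y'))%:R - ((Q X) + (Q Y))%:R.
  under eq_bigr => B _ do rewrite -(mul1r (d B)).
  by rewrite sumE !natrD; do 4!case: ifP => _.
have := @cost_minimal_direction P c w d cw wmin.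
rewrite sumE sumE1 PX PY PX' PY' subrr subr_ge0 => /(_ erefl); apply.
  move=> B PB; rewrite /d; case: (B =P X) => [-> //|_].
  by case: (B =P Y) => [-> //|_]; rewrite addr0 subr0 -natrD ltNge ler0n.
by move=> v; rewrite sumE1 PX PY PX' PY' /= subr_lt0 ltr_nat ltnNge cov.
Qed.

End OptimalCovers.

(** * Structure of triangle-free graphs *)

Section TriangleFree.
Variables (T : finType) (e : rel T).
Hypotheses (Ge : simple_graph e) (tf : triangle_free e).

Let eS : symmetric e := Ge.1.
Let eI : irreflexive e := Ge.2.

Lemma edge_neq x y : e x y -> x != y.
Proof. by apply: contraTneq => ->; rewrite eI. Qed.

Lemma no_triangle x y z : e x y -> e y z -> ~~ e x z.
Proof.
move=> exy eyz; apply/negP => exz; apply: (tf (A := [set x; y; z])).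
  apply/forall_inP => u; rewrite !inE => Hu; apply/forall_inP => v.
  rewrite !inE => Hv; apply/implyP.
  by move: Hu Hv => /orP[/orP[]|] /eqP-> /orP[/orP[]|] /eqP->;
    rewrite ?eqxx // eS.
by rewrite finset.setUC cardsU1 cards2 !inE (edge_neq exy) ![z == _]eq_sym
  (negPf (edge_neq exz)) (negPf (edge_neq eyz)).
Qed.

Lemma independentP (A : {set T}) :
  reflect {in A &, forall x y, ~~ e x y} (independent e A).
Proof.
apply: (iffP forall_inP) => [H x y xA yA|H x xA].
  by have /forall_inP := H x xA; apply.
by apply/forall_inP => y; apply: H.
Qed.

Lemma cliqueP (A : {set T}) :
  reflect {in A &, forall x y, x != y -> e x y} (clique e A).
Proof.
apply: (iffP forall_inP) => [H x y xA yA|H x xA].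
  by have /forall_inP/(_ y yA)/implyP := H x xA; apply.
by apply/forall_inP => y yA; apply/implyP; apply: H.
Qed.

Lemma independent_sub (A B : {set T}) :
  A \subset B -> independent e B -> independent e A.
Proof.
move=> /fintype.subsetP AB /independentP iB.
by apply/independentP => x y /AB xB /AB yB; apply: iB.
Qed.

Lemma clique_sub (A B : {set T}) :
  A \subset B -> clique e B -> clique e A.
Proof.
move=> /fintype.subsetP AB /cliqueP kB.
by apply/cliqueP => x y /AB xB /AB yB; apply: kB.
Qed.

(** A third vertex of the clique would form a triangle with an edge inside it. *)
Lemma clique_edge (A : {set T}) : clique e A -> ~~ independent e A ->
  exists x y, e x y /\ A = [set x; y].
Proof.
move=> /cliqueP kA /forall_inPn[x xA /forall_inPn[y yA /negPn exy]].
exists x, y; split=> //; apply/finset.setP => z; rewrite !inE.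
apply/idP/orP => [zA|[/eqP->|/eqP->] //]; apply/orP/negPn.
rewrite negb_or; apply/negP => /andP[zx zy].
have eyz : e y z by apply: kA => //; rewrite eq_sym.
by have /negP := no_triangle exy eyz; apply; apply: kA => //; rewrite eq_sym.
Qed.

Lemma independent2 x y : ~~ e x y -> independent e [set x; y].
Proof.
move=> nxy; apply/independentP => u v; rewrite !inE.
by move=> /orP[]/eqP-> /orP[]/eqP->; rewrite ?eI // eS.
Qed.

Lemma edge_union_bipartite a b (Y : {set T}) :
  e a b -> clique e Y || independent e Y -> a \notin Y -> b \notin Y ->
  exists I J, [/\ independent e I, independent e J &
    forall v, ((v \in [set a; b]) + (v \in Y) = (v \in I) + (v \in J))%N].
Proof.
move=> eab PY aY bY; have [iY|niY] := boolP (independent e Y).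
  have /independentP iYP := iY.
  (* Neighbours of [a] in [Y] go with [b], to which they cannot be adjacent; the other vertices of
     [Y] go with [a]. *)
  exists (a |: [set y in Y | ~~ e a y]), (b |: [set y in Y | e a y]); split.
  - apply/independentP => x y; rewrite !inE.
    case/predU1P => [->|/andP[xY ax]]; case/predU1P => [->|/andP[yY ay]] //.
    + by rewrite eI.
    + by rewrite eS.
    + exact: iYP.
  - have nb y : e a y -> ~~ e b y by apply: no_triangle; rewrite eS.
    apply/independentP => x y; rewrite !inE.
    case/predU1P => [->|/andP[xY ax]]; case/predU1P => [->|/andP[yY ay]] //.
    + by rewrite eI.
    + exact: nb.
    + by rewrite eS nb.
    + exact: iYP.
  - move=> v; rewrite !inE; have [->|va] := eqVneq v a.
      by rewrite (negPf aY) (negPf (edge_neq eab)).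
    have [->|vb] := eqVneq v b; first by rewrite (negPf bY).
    by case: (v \in Y); case: (e a v).
have kY : clique e Y by move: PY; rewrite (negPf niY) orbF.
have [x [y [exy EY]]] := clique_edge kY niY.
(* Now [Y] is an edge, and the classes are [{a, u}] and [{b, v}]. If [a] is adjacent to [x], or [b]
   to [y], the absence of triangles forces the swap [u = y], [v = x]; otherwise [u = x], [v = y]
   works. *)
suff [u [v [nau nbv Euv]]] : exists u v, [/\ ~~ e a u, ~~ e b v & Y = [set u; v]].
  exists [set a; u], [set b; v]; split; [exact: independent2 ..|].
  have uv : u != v.
    apply: contraTneq exy => uv; move: EY; rewrite Euv uv finset.setUid => E.
    have /set1P-> : x \in [set v] by rewrite E set21.
    have /set1P-> : y \in [set v] by rewrite E set22.
    by rewrite eI.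
  move: aY bY; rewrite Euv !inE !negb_or => /andP[au av] /andP[bu bv] t.
  have ab := edge_neq eab; rewrite !inE.
  have [->|ta] := eqVneq t a; first by rewrite (negPf ab) (negPf au) (negPf av).
  have [->|tb] := eqVneq t b; first by rewrite (negPf bu) (negPf bv).
  by have [->|tu] := eqVneq t u; rewrite ?(negPf uv).
have [ax|nax] := boolP (e a x).
  exists y, x; split; [exact: no_triangle ax exy| |by rewrite finset.setUC].
  by apply: no_triangle _ ax; rewrite eS.
have [by_|nby] := boolP (e b y); last by exists x, y.
exists y, x; split; [exact: no_triangle eab by_| |by rewrite finset.setUC].
by apply: no_triangle by_ _; rewrite eS.
Qed.

(** * Recognizing a star with possible isolated vertices *)

Section Star.
Variables (c l : T).
Hypotheses (ecl : e c l) (star : forall x y, e x y -> (x == c) || (y == c)).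

Let L := [set x | e c x].
(** These are the isolated vertices, since every edge contains [c]. *)
Let S := [set x | (x != c) && ~~ e c x].

Let lL : l \in L. Proof. by rewrite inE. Qed.

Let L_gt0 : (0 < #|L|)%N. Proof. by apply/card_gt0P; exists l. Qed.

(** The isomorphism on the star component; on [S] it takes a meaningless default value, whence the
    restrictions to the complement of [S] below. *)
Let hub (x : T) : ('I_1 + 'I_#|L|)%type :=
  if x == c then inl ord0 else inr (enum_rank_in lL x).

Let hub_inv (u : 'I_1 + 'I_#|L|) : T :=
  match u with inl _ => c | inr i => enum_val i end.

Let hub_invK : cancel hub_inv hub.
Proof.
rewrite /hub => -[i|i] /=; first by rewrite eqxx [i]ord1.
have := enum_valP i; rewrite inE => /edge_neq.
by rewrite eq_sym => /negPf->; rewrite enum_valK_in.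
Qed.

Let hubK x : x \notin S -> hub_inv (hub x) = x.
Proof.
rewrite inE negb_and !negbK /hub; case: (x =P c) => [->|_] //= ecx.
by rewrite enum_rankK_in // inE.
Qed.

Let hub_invS u : hub_inv u \notin S.
Proof.
rewrite inE negb_and !negbK; case: u => [i|i] /=; first by rewrite eqxx.
by have := enum_valP i; rewrite inE => ->; rewrite orbT.
Qed.

Let nonadjacent x y : x != c -> y != c -> e x y = false.
Proof.
by move=> /negPf xc /negPf yc; apply: contraFF xc => /star; rewrite yc orbF.
Qed.

Let hub_edge x y : x \notin S -> y \notin S ->
  complete_bipartite 1 #|L| (hub x) (hub y) = e x y.
Proof.
rewrite !inE !negb_and !negbK /hub.
have [->|xc] := eqVneq x c; have [->|yc] /= := eqVneq y c => //.
- by rewrite eS => ->.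
- by rewrite (nonadjacent xc yc).
Qed.

Let nonadjacentS x y : x \in S -> e x y = false.
Proof.
rewrite inE => /andP[xc necx]; have [->|yc] := eqVneq y c.
  by rewrite eS (negPf necx).
exact: nonadjacent.
Qed.

Lemma star_graph_iso :
  exists2 t, (1 <= t)%N & graph_iso e (complete_bipartite 1 t) \/
    exists2 s, (1 <= s)%N &
      graph_iso e (graph_union (complete_bipartite 1 t) (edgeless s)).
Proof.
exists #|L| => //; have [S0|[x0 x0S]] := set_0Vmem S.
  have nS x : x \notin S by rewrite S0 inE.
  left; exists hub; last by move=> x y; apply: hub_edge.
  by exists hub_inv => // x; apply: hubK.
right; exists #|S|; first by apply/card_gt0P; exists x0.
exists (fun x => if x \in S then inr (enum_rank_in x0S x) else inl (hub x)).
  exists (fun u => match u with inl v => hub_inv v | inr i => enum_val i end).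
    move=> x; case: ifPn => xS; last exact: hubK.
    exact: enum_rankK_in.
  case=> [u|i]; first by rewrite (negPf (hub_invS u)) hub_invK.
  by rewrite enum_valP enum_valK_in.
move=> x y; case: ifPn => xS; first by case: ifPn => yS; rewrite nonadjacentS.
case: ifPn => yS; first by rewrite eS nonadjacentS.
exact: hub_edge.
Qed.

End Star.

(** The centre is [a] if [a] has a neighbour other than [b], and [b] otherwise. *)
Lemma pairwise_meeting_edges a b : e a b ->
  (forall x y, e x y -> [|| x == a, x == b, y == a | y == b]) ->
  (forall x y, e a x -> e b y -> x != b -> y != a -> x = y) ->
  exists c l, e c l /\ forall x y, e x y -> (x == c) || (y == c).
Proof.
move=> eab meet meet2.
have [/existsP[x /andP[eax xb]]|/existsPn na] :=
    boolP [exists x, e a x && (x != b)].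
  exists a, b; split=> // u v.
  suff H p q : e p q -> p = b -> q = a.
    move=> euv; case/or4P: (meet _ _ euv) => /eqP E; first by rewrite E eqxx.
    - by rewrite (H _ _ euv E) eqxx orbT.
    - by rewrite E eqxx orbT.
    - by rewrite eS in euv; rewrite (H _ _ euv E) eqxx.
  (* An edge [b q] avoiding [a] must meet [a x] in [q = x], which closes the triangle [a b x]. *)
  move=> epq pb; rewrite pb in epq; apply/eqP/negPn/negP => qa.
  have xq := meet2 _ _ eax epq xb qa; rewrite -xq in epq.
  by have /negP := no_triangle eab epq.
exists b, a; split; first by rewrite eS.
have H p q : e p q -> p = a -> q = b.
  by move=> epq pa; have := na q; rewrite -pa epq /= negbK => /eqP.
move=> u v euv; case/or4P: (meet _ _ euv) => /eqP E.
- by rewrite (H _ _ euv E) eqxx orbT.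
- by rewrite E eqxx.
- by rewrite eS in euv; rewrite (H _ _ euv E) eqxx.
- by rewrite E eqxx orbT.
Qed.

(** * Fractional cocolorings and the comparison of the two parameters *)

Section Cocolorings.
Variable R : realType.
Implicit Type w : {set T} -> R.
Let P := [predU clique e & independent e].

Let PE A : P A = clique e A || independent e A. Proof. by []. Qed.

Lemma coverageE (Q : pred {set T}) w v :
  \sum_(A | Q A && (v \in A)) w A = \sum_(A | Q A) (v \in A)%:R * w A.
Proof.
rewrite big_mkcondr; apply: eq_bigr => A _.
by case: (v \in A); rewrite ?mul1r ?mul0r.
Qed.

Lemma edge_meets a b A : e a b -> independent e A -> ((a \in A) + (b \in A) <= 1)%N.
Proof.
move=> eab /independentP iA; have [aA|] := boolP (a \in A); last by case: (b \in A).
have [bA|//] := boolP (b \in A); by have := iA _ _ aA bA; rewrite eab.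
Qed.

Lemma cocoloring_ge2 a b x y w :
  e a b -> e x y -> uniq [:: a; b; x; y] ->
  fractional_cocoloring e w -> 2 <= total_weight P w.
Proof.
move=> eab exy U [w0 w1].
(* Double counting: the four ends need coverage 4 in total, and each admissible set contains at most
   two of them. *)
suff : \sum_(v <- [:: a; b; x; y]) 1 <= 2 * total_weight P w.
  by rewrite !big_cons big_nil; lra.
apply: (@le_trans _ _ (\sum_(v <- [:: a; b; x; y])
    \sum_(A | P A) (v \in A)%:R * w A)).
  by apply: ler_sum => v _; rewrite -coverageE; exact: w1.
rewrite exchange_big /total_weight mulr_sumr /=; apply: ler_sum => A PA.
rewrite -mulr_suml ler_wpM2r ?w0 // -natr_sum ler_nat !big_cons big_nil addn0.
case/orP: PA => [kA|iA]; last first.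
  by rewrite addnA (leq_add (edge_meets eab iA) (edge_meets exy iA)).
have [iA|niA] := boolP (independent e A).
  by rewrite addnA (leq_add (edge_meets eab iA) (edge_meets exy iA)).
have [p [q [epq ->]]] := clique_edge kA niA.
have -> : 2%N = #|[set p; q]| by rewrite cards2 (edge_neq epq).
pose vs := [:: a; b; x; y].
have -> : ((a \in [set p; q]) + ((b \in [set p; q]) + ((x \in [set p; q]) +
    (y \in [set p; q])))%N)%N = size [seq v <- vs | v \in [set p; q]].
  by rewrite size_filter /= addn0.
rewrite cardE uniq_leq_size ?filter_uniq // => v.
by rewrite mem_filter mem_enum => /andP[].
Qed.

(** The size term rewards deleting a vertex; the penalty rewards replacing an edge by independent
    sets of the same total size. *)
Let cost (A : {set T}) : R := (#|A| + ~~ independent e A)%:R.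

Let cost_minimal_no_disjoint w a b Y : fractional_cover P w ->
  cost_minimal P cost w -> e a b -> 0 < w [set a; b] -> P Y -> 0 < w Y ->
  (a \in Y) || (b \in Y).
Proof.
move=> cw wmin eab wab PY wY; apply/negPn/negP; rewrite negb_or => /andP[aY bY].
have [I [J [iI iJ cov]]] := edge_union_bipartite eab PY aY bY.
have kab : clique e [set a; b].
  apply/cliqueP => u v; rewrite !inE.
  by move=> /orP[]/eqP-> /orP[]/eqP->; rewrite ?eqxx // eS.
have nab : ~~ independent e [set a; b].
  apply/negP => /independentP iab.
  by have := iab a b (set21 a b) (set22 a b); rewrite eab.
have cardE2 (A B : {set T}) :
    (#|A| + #|B| = \sum_v ((v \in A) + (v \in B)))%N.
  by rewrite big_split -!sum1_card !(big_mkcond (fun v => v \in _)).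
have : cost [set a; b] + cost Y <= cost I + cost J.
  apply: (cost_minimal_exchange cw wmin) => //.
  - by rewrite PE kab.
  - by rewrite PE iI orbT.
  - by rewrite PE iJ orbT.
  - by move=> v; rewrite cov.
(* Equal multiplicities give equal total sizes, so the exchange saves at least the penalty of
   [{a, b}], contradicting minimality. *)
have cE : (#|[set a; b]| + #|Y| = #|I| + #|J|)%N.
  by rewrite !cardE2; apply: eq_bigr => v _; exact: cov.
rewrite /cost -!natrD ler_nat iI iJ nab !addn0 -cE.
by rewrite addnACA -[leqRHS]addn0 leq_add2l.
Qed.

Lemma support_edge_lt2 w a b : fractional_cover P w ->
  (forall v, \sum_(A | P A && (v \in A)) w A = 1) ->
  P [set a; b] -> a != b -> 0 < w [set a; b] ->
  (forall Y, P Y -> 0 < w Y -> (a \in Y) || (b \in Y)) ->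
  total_weight P w < 2.
Proof.
move=> [w0 _] exact1 Pab ab wab meet.
(* The coverages of [a] and [b] add up to exactly 2 and bound this sum termwise. *)
apply: (@lt_le_trans _ _ (total_weight P w + w [set a; b])).
  by rewrite ltrDl.
have -> : 2 = \sum_(A | P A) (a \in A)%:R * w A + \sum_(A | P A) (b \in A)%:R * w A.
  by rewrite -!coverageE !exact1.
have -> : w [set a; b] = \sum_(A | P A) w A * (A == [set a; b])%:R.
  by rewrite sum_indicator Pab.
rewrite /total_weight -!big_split /=; apply: ler_sum => A PA.
have [->|_] := eqVneq A [set a; b].
  by rewrite set21 set22 mulr1 mul1r.
rewrite mulr0 addr0 -mulrDl.
have [wA|] := ltP 0 (w A); last first.
  move=> wA; have -> : w A = 0 by apply/le_anti; rewrite wA w0.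
  by rewrite mulr0.
rewrite ler_peMl ?w0 // -natrD ler1n.
by have := meet _ PA wA; case: (a \in A); case: (b \in A).
Qed.

Lemma sum_independent w (Q : pred {set T}) :
  (forall A, P A -> ~~ independent e A -> w A = 0) ->
  \sum_(A | P A && Q A) w A = \sum_(A | independent e A && Q A) w A.
Proof.
move=> w0; rewrite big_mkcond [RHS]big_mkcond; apply: eq_bigr => A _.
have := w0 A; rewrite PE; case: (independent e A); first by rewrite orbT.
by case: (clique e A) => //= ->; rewrite ?if_same.
Qed.

Lemma total_weight_independent w :
  (forall A, P A -> ~~ independent e A -> w A = 0) ->
  total_weight P w = total_weight (independent e) w.
Proof.
move=> /(sum_independent predT); rewrite /total_weight.
by under eq_bigl do rewrite andbT; under [RHS]eq_bigl do rewrite andbT.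
Qed.

Lemma cocoloring_dichotomy :
  chi_f R e <= Z_f R e \/ Z_f R e < 2 /\ exists a b, e a b.
Proof.
have P1 v : P [set v].
  by rewrite PE; apply/orP; left; apply/cliqueP => x y /set1P-> /set1P->; rewrite eqxx.
have Psub (A B : {set T}) : A \subset B -> P B -> P A.
  move=> AB; rewrite !PE => /orP[kB|iB]; first by rewrite (clique_sub AB).
  by rewrite (independent_sub AB iB) orbT.
have [w [cw tw wmin]] := exists_cost_minimal cost P1.
have exact1 : forall v, \sum_(A | P A && (v \in A)) w A = 1.
  apply: (cost_minimal_exact _ _ cw wmin) => A v PA vA.
    by apply: Psub PA; exact: subD1set.
  rewrite /cost ltr_nat (cardsD1 v A) vA add1n addSn ltnS leq_add2l.
  (* Deleting [v] lowers the size by one, and the penalty cannot rise because independence passes to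
     subsets. *)
  have [iA|_] := boolP (independent e A).
    by rewrite (independent_sub _ iA) // subD1set.
  exact: leq_b1.
(* The alternatives: some edge carries positive weight, or [w] is supported on independent sets. *)
have [/existsP[X /and3P[kX niX wX]]|/existsPn H] :=
    boolP [exists X, [&& clique e X, ~~ independent e X & 0 < w X]].
  right; have [a [b [eab EX]]] := clique_edge kX niX; rewrite EX in kX wX.
  split; last by exists a, b.
  rewrite /Z_f -tw; apply: (support_edge_lt2 cw exact1 _ (edge_neq eab) wX).
    by rewrite PE kX.
  by move=> Y; apply: cost_minimal_no_disjoint.
left.
have w0 A : P A -> ~~ independent e A -> w A = 0.
  rewrite PE => PA niA; apply/le_anti; rewrite cw.1 // andbT leNgt.
  have := H A; rewrite niA /=.
  by move: PA; rewrite (negPf niA) orbF => ->.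
have [_ chi_min] := chi_f_min R eI.
rewrite /Z_f -tw (total_weight_independent w0); apply: chi_min.
split=> [A iA|v]; first by apply: cw.1; rewrite PE iA orbT.
by rewrite -(sum_independent _ w0) exact1.
Qed.

(** An optimal coloring, extended by 0 to the cliques that are not independent, is a cocoloring of
    the same weight. *)
Lemma Z_f_le_chi_f : Z_f R e <= chi_f R e.
Proof.
have [[w [w0 w1] <-] _] := chi_f_min R eI; have [_ Zmin] := Z_f_min R e.
pose w' A := if independent e A then w A else 0.
have w'0 A : P A -> ~~ independent e A -> w' A = 0.
  by move=> _ /negPf niA; rewrite /w' niA.
have <- : total_weight P w' = total_weight (independent e) w.
  rewrite (total_weight_independent w'0); apply: eq_bigr => A iA.
  by rewrite /w' iA.
apply: Zmin; split=> [A _|v]; first by rewrite /w'; case: ifP => // /w0.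
rewrite (sum_independent _ w'0) [leRHS](_ : _ =
  \sum_(A | independent e A && (v \in A)) w A); first exact: w1.
by apply: eq_bigr => A /andP[iA _]; rewrite /w' iA.
Qed.

End Cocolorings.
End TriangleFree.

Theorem theorem4 (R : realType) (T : finType) (e : rel T)
    (Ge : simple_graph e)
    (tf : triangle_free e)
    (nstar : forall t : nat, (1 <= t)%N ->
       ~ graph_iso e (complete_bipartite 1 t))
    (nstar_iso : forall s t : nat, (1 <= s)%N -> (1 <= t)%N ->
       ~ graph_iso e (graph_union (complete_bipartite 1 t) (edgeless s))) :
  chi_f R e = Z_f R e.
Proof.
apply/le_anti; rewrite Z_f_le_chi_f // andbT.
have [//|[Zlt2 [a [b eab]]]] := cocoloring_dichotomy Ge tf R.
(* Two disjoint edges would contradict [Z_f R e < 2]; hence the edges meet pairwise and share a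
   centre [c]. *)
have meet a' b' x y : e a' b' -> e x y -> ~~ uniq [:: a'; b'; x; y].
  move=> eab' exy; apply/negP => U; move: Zlt2; rewrite ltNge => /negP; apply.
  have [[w cw <-] _] := Z_f_min R e.
  exact: cocoloring_ge2 eab' exy U cw.
have [||c [l [ecl star]]] := pairwise_meeting_edges Ge tf eab.
- move=> x y exy; have := meet _ _ _ _ eab exy.
  rewrite /= !inE (negPf (edge_neq Ge eab)) (negPf (edge_neq Ge exy)) /= andbT.
  rewrite negb_and !negbK ![_ == a]eq_sym ![_ == b]eq_sym.
  by case: (a == x); case: (a == y); case: (b == x); case: (b == y).
- move=> x y eax eby xb ya; have := meet _ _ _ _ eax eby.
  rewrite /= !inE (negPf (edge_neq Ge eab)) (negPf (edge_neq Ge eax)).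
  rewrite (negPf (edge_neq Ge eby)) (negPf xb) [a == y]eq_sym (negPf ya) /=.
  by rewrite !andbT negbK => /eqP.
- have [t t1 [iso|[s s1 iso]]] := star_graph_iso Ge ecl star.
    by case: (nstar t t1 iso).
  by case: (nstar_iso s t s1 t1 iso).
Qed.
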